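(* Let $X,Y$ be types, $\varepsilon\colon\mathbb{N}\to(X\to Y)\to X$, $q\colon X^{\mathbb{N}}\to Y$, $\varphi\colon X^{\mathbb{N}}\to\mathbb{N}$, and let $\Psi\colon X^\dagger\to X^\dagger$ satisfy, for all $u\colon X^\dagger$, $$\Psi(u)=u\,@\begin{cases}\emptyset&\text{if }n_u\in\mathrm{dom}(u),\\ \Psi(u\oplus(n_u,a_u))&\text{otherwise,}\end{cases}$$ where $n_u=\varphi(\hat u)$ and $a_u=\varepsilon_{n_u}\big(\lambda x.\,\hat q(\Psi(u\oplus(n_u,x)))\big)$. Define $v:=\Psi(\emptyset)$ and, for $i<|\mathrm{dom}(v)|$, $n_i:=\hat\varphi([v]^{\varphi}_{i})$ and $p_i:=\lambda x^X.\,\hat q\big(\Psi([v]^{\varphi}_{i}\oplus(n_i,x))\big)\colon X\to Y$. Then for all $0\le i<|\mathrm{dom}(v)|$, $$v(n_i)=\varepsilon_{n_i}(p_i)\quad\text{and}\quad\hat q(v)=p_i(\varepsilon_{n_i}(p_i)).$$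
   Context: The setting is $\mathsf{E\text{-}HA}^\omega$ (extensional Heyting arithmetic in all finite types) extended by a constant $\Psi$ with the displayed defining equation. $X^{\mathbb{N}}$ is $\mathbb{N}\to X$; $X^\dagger$ is the type of finite partial functions from $\mathbb{N}$ to $X$ with decidable finite domain $\mathrm{dom}(u)$, $|\mathrm{dom}(u)|$ its cardinality; $\emptyset$ is the nowhere-defined one. $\mathbf{0}_X$ is the canonical element of $X$; $\hat u\colon X^{\mathbb{N}}$ agrees with $u$ on $\mathrm{dom}(u)$ and is $\mathbf{0}_X$ elsewhere; $\hat q(u):=q(\hat u)$, $\hat\varphi(u):=\varphi(\hat u)$. $\varepsilon_n$ means $\varepsilon(n)$. $u\oplus(n,x)$ equals $u$ if $n\in\mathrm{dom}(u)$, otherwise $u$ extended with value $x$ at $n$. $u\,@\,w$ is the union of the partial functions $u,w$, taking the value of $u$ where both are defined. The $\varphi$-thread of $u$: $[u]^{\varphi}_{0}=\emptyset$, $[u]^{\varphi}_{i+1}=[u]^{\varphi}_{i}\oplus(m_i,u(m_i))$ if $m_i\in\mathrm{dom}(u)$ and $[u]^{\varphi}_{i}$ otherwise, with $m_i:=\hat\varphi([u]^{\varphi}_{i})$. *)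

(* Defs.v *)
From mathcomp Require Import all_boot finmap.

Set Implicit Arguments.
Unset Strict Implicit.
Unset Printing Implicit Defensive.

Local Open Scope fset_scope.
Local Open Scope fmap_scope.

(* The finite types of E-HA^omega are read as arbitrary Rocq types.  The
   canonical element 0_X is passed explicitly as [x0]; it can be any element
   of X, so X is inhabited but otherwise unrestricted. *)

Definition pfun (X : Type) := {fmap nat -> X}.

Definition hat (X : Type) (x0 : X) (u : pfun X) : nat -> X :=
  fun n => if u.[? n] is Some x then x else x0.

Definition hatf (X Z : Type) (x0 : X) (f : (nat -> X) -> Z) (u : pfun X) : Z :=
  f (hat x0 u).

Definition extend (X : Type) (u : pfun X) (n : nat) (x : X) : pfun X :=
  if n \in domf u then u else u.[n <- x].

(* u @ w: on a common key [catf] keeps its right operand, hence the swap. *)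
Definition merge_left (X : Type) (u w : pfun X) : pfun X := w + u.

Fixpoint thread (X : Type) (x0 : X) (phi : (nat -> X) -> nat) (u : pfun X)
    (i : nat) : pfun X :=
  if i is j.+1 then
    let t := thread x0 phi u j in
    let m := hatf x0 phi t in
    if u.[? m] is Some x then extend t m x else t
  else [fmap].

(* Main.v *)
(** Write t_i for the i-th thread of v.  As long as i < |dom v|, the point n_i
    is new for t_i: otherwise Psi would stop at t_i and v = Psi t_i = t_i would
    have only i elements.  So Psi t_i unfolds to t_i @ Psi (t_i (+) (n_i, a)),
    where a = eps_{n_i}(p_i); since Psi extends its argument, the merge is
    redundant and v = Psi (t_i (+) (n_i, a)).  Hence v(n_i) = a, so
    t_{i+1} = t_i (+) (n_i, a), and Psi t_i = v holds along the thread. *)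
Require Import Defs.
From mathcomp Require Import all_boot finmap.

Local Open Scope fset_scope.
Local Open Scope fmap_scope.

Lemma merge_left0 (X : Type) (u : pfun X) : merge_left u [fmap] = u.
Proof. by apply/fmapP => k; rewrite fnd_cat fnd_fmap0; case: fndP. Qed.

Lemma merge_left_absorb (X : Type) (u w : pfun X) :
  (forall k, k \in domf u -> w.[? k] = u.[? k]) -> merge_left u w = w.
Proof. by move=> uw; apply/fmapP => k; rewrite fnd_cat; case: ifP => // /uw. Qed.

Lemma merge_left_fnd (X : Type) (u w : pfun X) (k : nat) :
  k \in domf u -> (merge_left u w).[? k] = u.[? k].
Proof. by move=> uk; rewrite fnd_cat uk. Qed.

Theorem theorem3p5 (X Y : Type) (x0 : X)
    (eps : nat -> (X -> Y) -> X) (q : (nat -> X) -> Y) (phi : (nat -> X) -> nat)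
    (Psi : pfun X -> pfun X)
    (Psi_eq : forall u : pfun X,
       let n_u := phi (hat x0 u) in
       let a_u := eps n_u (fun x : X => hatf x0 q (Psi (extend u n_u x))) in
       Psi u = merge_left u (if n_u \in domf u then [fmap]
                             else Psi (extend u n_u a_u))) :
  let v : pfun X := Psi [fmap] in
  let n (i : nat) : nat := hatf x0 phi (thread x0 phi v i) in
  let p (i : nat) : X -> Y :=
    fun x : X => hatf x0 q (Psi (extend (thread x0 phi v i) (n i) x)) in
  forall i : nat, (i < #|` domf v|)%N ->
    v.[? n i] = Some (eps (n i) (p i)) /\
    hatf x0 q v = p i (eps (n i) (p i)).
Proof.
move=> v n p.
(* One unfolding suffices, without recursion: the merge keeps the values of its left operand [u],
   whatever the right one is. *)
have Psi_fnd u k : k \in domf u -> (Psi u).[? k] = u.[? k].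
  by rewrite Psi_eq; exact: merge_left_fnd.
have step i : Psi (thread x0 phi v i) = v -> (#|` domf (thread x0 phi v i)| = i)%N ->
    (i < #|` domf v|)%N ->
    n i \notin domf (thread x0 phi v i) /\
    Psi (extend (thread x0 phi v i) (n i) (eps (n i) (p i))) = v.
  set t := thread x0 phi v i => Psi_t card_t lt_i.
  have := Psi_eq t; rewrite /= -/(hatf x0 phi t) -/(n i) -/(p i).
  case: ifPn => [_ | n_t]; rewrite Psi_t.
    by rewrite merge_left0 => vt; rewrite vt card_t ltnn in lt_i.
  rewrite merge_left_absorb => [<- // | k tk].
  (* The new point [n i] lies outside the domain of [t], so adding it leaves the value at [k]
     unchanged. *)
  have kn : k != n i by apply: contraNneq n_t => <-.
  rewrite Psi_fnd /extend (negPf n_t) ?fnd_set ?(negPf kn) //.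
  by rewrite mem_setf inE tk orbT.
have fnd_v i : n i \notin domf (thread x0 phi v i) ->
    Psi (extend (thread x0 phi v i) (n i) (eps (n i) (p i))) = v ->
    v.[? n i] = Some (eps (n i) (p i)).
  move=> n_t <-; rewrite /extend (negPf n_t) Psi_fnd ?fnd_set ?eqxx //.
  by rewrite fset1U1.
(* The cardinality is carried along because it excludes the stopping case in [step]. *)
have inv i : (i <= #|` domf v|)%N ->
    Psi (thread x0 phi v i) = v /\ (#|` domf (thread x0 phi v i)| = i)%N.
  elim: i => [|i IHi] lt_i; first by split; rewrite //= cardfs0.
  have [Psi_t card_t] := IHi (ltnW lt_i).
  have [n_t Psi_ext] := step i Psi_t card_t lt_i.
  have v_n := fnd_v i n_t Psi_ext.
  (* By [v_n] the next thread takes its extending branch and is exactly the argument of [Psi] in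
     [Psi_ext]. *)
  rewrite /= -/(n i) v_n; split=> //.
  by rewrite /extend (negPf n_t) /= cardfsU1 n_t card_t.
move=> i lt_i; have [Psi_t card_t] := inv i (ltnW lt_i).
have [n_t Psi_ext] := step i Psi_t card_t lt_i.
by split; [exact: fnd_v | rewrite /p Psi_ext].
Qed.
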